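(* Let $\zeta=(\zeta_0,\zeta_1)\in\mathbb{R}^2$. (1) If $\zeta_0<\zeta_1$, then the $\theta_\zeta$-stable $A$-modules $W$ are, up to isomorphism, classified as follows: - $C^-_+(m)$ for $m\ge 1$; - the $\theta_\zeta$-stable $A$-modules $W$ with $\underline{\dim}\,W=(1,1)$, which are parameterized by $Y$; - $C^-_-(m)$ for $m\ge 0$. (2) If $\zeta_0>\zeta_1$, then the $\theta_\zeta$-stable $A$-modules $W$ are, up to isomorphism, classified as follows: - $C^+_+(m)$ for $m\ge 1$; - the $\theta_\zeta$-stable $A$-modules $W$ with $\underline{\dim}\,W=(1,1)$, which are parameterized by $Y^+$; - $C^+_-(m)$ for $m\ge 0$.
   Context: $X=\{(x,y,z,w)\in\mathbb{C}^4\mid xy-zw=0\}$ is the conifold, $f\colon Y\to X$ is its crepant resolution with $Y$ the total space of $\mathcal{O}_{\mathbb{P}^1}(-1)\oplus\mathcal{O}_{\mathbb{P}^1}(-1)$ over $\mathbb{P}^1$, and $f^+\colon Y^+\to X$ is the flop of $Y$. Let $Q$ be the quiver with vertices $0,1$, two arrows $a_1,a_2$ from $0$ to $1$, and two arrows $b_1,b_2$ from $1$ to $0$. Let $A=\mathbb{C}Q/(a_1b_ia_2=a_2b_ia_1,\ b_1a_ib_2=b_2a_ib_1)_{i=1,2}$. A finite dimensional $A$-module $W$ is a pair of finite dimensional vector spaces $W_0,W_1$ with linear maps $a_i\colon W_0\to W_1$, $b_i\colon W_1\to W_0$ satisfying these relations; $\underline{\dim}\,W=(\dim W_0,\dim W_1)$.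 All $A$-modules in the statement are finite dimensional. For $\zeta\in\mathbb{R}^2$ and $W\neq 0$ put $\theta_\zeta(W)=\dfrac{\zeta_0\dim W_0+\zeta_1\dim W_1}{\dim W_0+\dim W_1}$. A nonzero $W$ is $\theta_\zeta$-stable if $\theta_\zeta(W')<\theta_\zeta(W)$ for every nonzero proper submodule $W'\subsetneq W$. The modules $C^\pm_\pm(m)$ are the following (unique up to isomorphism) modules, given by indecomposable representations of the Kronecker quiver. - $C^-_+(m)$ ($m\ge1$): $W_0=\mathbb{C}^m$, $W_1=\mathbb{C}^{m-1}$, $a_1=a_2=0$, $b_1(e_i)=f_i$, $b_2(e_i)=f_{i+1}$ for standard bases $e_i$ of $W_1$, $f_i$ of $W_0$. - $C^-_-(m)$ ($m\ge0$): $W_0=\mathbb{C}^m$, $W_1=\mathbb{C}^{m+1}$, $a_1=a_2=0$, $b_1(e_i)=f_i$ for $i\le m$, $b_1(e_{m+1})=0$, $b_2(e_1)=0$, $b_2(e_i)=f_{i-1}$ for $i\ge2$. - $C^+_+(m)$ ($m\ge1$): $W_0=\mathbb{C}^m$, $W_1=\mathbb{C}^{m-1}$, $b_1=b_2=0$, $a_1(f_i)=e_i$ for $i\le m-1$, $a_1(f_m)=0$, $a_2(f_1)=0$, $a_2(f_i)=e_{i-1}$ for $i\ge 2$. - $C^+_-(m)$ ($m\ge0$): $W_0=\mathbb{C}^m$, $W_1=\mathbb{C}^{m+1}$, $b_1=b_2=0$, $a_1(f_i)=e_i$, $a_2(f_i)=e_{i+1}$. *)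

(* Defs.v *)
From HB Require Import structures.
From mathcomp Require Import all_boot all_order all_algebra.
From mathcomp Require Import reals.

Set Implicit Arguments.
Unset Strict Implicit.
Unset Printing Implicit Defensive.

Import Order.TTheory GRing.Theory Num.Theory.
Local Open Scope ring_scope.

(* Indices are shifted by one: a 0, a 1, b 0, b 1 are the arrows a_1, a_2,
   b_1, b_2. *)
Record conifold_module (K : fieldType) := ConifoldModule {
  sp0 : vectType K;
  sp1 : vectType K;
  arr_a : 'I_2 -> 'Hom(sp0, sp1);
  arr_b : 'I_2 -> 'Hom(sp1, sp0);
  rel_a : forall i,
    (arr_a 0 \o arr_b i \o arr_a 1 = arr_a 1 \o arr_b i \o arr_a 0)%VF;
  rel_b : forall i,
    (arr_b 0 \o arr_a i \o arr_b 1 = arr_b 1 \o arr_a i \o arr_b 0)%VF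
}.

Section Modules.
Variable K : fieldType.
Implicit Types V W : conifold_module K.

Definition dim_vector W : nat * nat := (\dim {: sp0 W}, \dim {: sp1 W}).

Definition module_iso V W : Prop :=
  exists (p0 : 'Hom(sp0 V, sp0 W)) (p1 : 'Hom(sp1 V, sp1 W)),
    [/\ bijective p0, bijective p1,
        forall i, (p1 \o arr_a V i = arr_a W i \o p0)%VF
      & forall i, (p0 \o arr_b V i = arr_b W i \o p1)%VF].

Definition submodule W (U0 : {vspace sp0 W}) (U1 : {vspace sp1 W}) : Prop :=
  forall i, (arr_a W i @: U0 <= U1)%VS /\ (arr_b W i @: U1 <= U0)%VS.

Definition slope (R : realType) (zeta : 'rV[R]_2) (d : nat * nat) : R :=
  (zeta 0 0 * d.1%:R + zeta 0 1 * d.2%:R) / (d.1 + d.2)%:R.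

Definition stable (R : realType) (zeta : 'rV[R]_2) W : Prop :=
  dim_vector W <> (0%N, 0%N) /\
  forall (U0 : {vspace sp0 W}) (U1 : {vspace sp1 W}),
    submodule U0 U1 ->
    (U0, U1) <> (0%VS, 0%VS) ->
    (U0, U1) <> (fullv, fullv) ->
    slope zeta (\dim U0, \dim U1) < slope zeta (dim_vector W).

Fact comp0_rel (E F : vectType K) (f : 'I_2 -> 'Hom(E, F)) (i : 'I_2) :
  (f 0 \o (0 : 'Hom(F, E)) \o f 1 = f 1 \o (0 : 'Hom(F, E)) \o f 0)%VF.
Proof. by apply/lfunP=> x; rewrite !(comp_lfunE, lfunE, linear0). Qed.

Fact zero_comp_rel (E F : vectType K) (f : 'I_2 -> 'Hom(E, F)) (i : 'I_2) :
  ((0 : 'Hom(F, E)) \o f i \o (0 : 'Hom(F, E))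
   = (0 : 'Hom(F, E)) \o f i \o (0 : 'Hom(F, E)))%VF.
Proof. by []. Qed.

Definition module_of_a (E F : vectType K) (f : 'I_2 -> 'Hom(E, F)) :=
  @ConifoldModule K E F f (fun=> 0) (comp0_rel f) (zero_comp_rel f).

Definition module_of_b (E F : vectType K) (f : 'I_2 -> 'Hom(F, E)) :=
  @ConifoldModule K E F (fun=> 0) f (zero_comp_rel f) (comp0_rel f).

(* Standard basis vectors are rows and maps act by right multiplication, so
   row j of the matrix is the image of the j-th basis vector.  As i is 0 or 1,
   [kron_up i] sends e_j to f_(j+i) and [kron_down i] sends e_j to f_(j-i);
   a vector whose index is out of range is zero. *)
Definition kron_up p q (i : 'I_2) : 'Hom('rV[K]_p, 'rV[K]_q) :=
  linfun (mulmxr (\matrix_(j < p, k < q) (j + i == k :> nat)%N%:R)).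

Definition kron_down p q (i : 'I_2) : 'Hom('rV[K]_p, 'rV[K]_q) :=
  linfun (mulmxr (\matrix_(j < p, k < q) (j == k + i :> nat)%N%:R)).

(* [Cminus_plus m] and [Cplus_plus m] are meant for 1 <= m only. *)
Definition Cminus_plus m := module_of_b (@kron_up m.-1 m).
Definition Cminus_minus m := module_of_b (@kron_down m.+1 m).
Definition Cplus_plus m := module_of_a (@kron_down m m.-1).
Definition Cplus_minus m := module_of_a (@kron_up m m.+1).

Record conifold := Conifold {
  cx : K; cy : K; cz : K; cw : K;
  conifold_eq : cx * cy - cz * cw = 0
}.

(* A closed point of the total space of O(-1) (+) O(-1) over P^1: a line in
   K^2 together with two vectors of this line. *)
Record totO := TotO {
  line : {vspace 'rV[K]_2};
  dim_line : \dim line == 1%N;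
  sec : {ffun 'I_2 -> subvs_of line}
}.

Definition vec (t : totO) (i : 'I_2) : 'rV[K]_2 := vsval (sec t i).

Definition coords (t : totO) : {vspace 'rV[K]_2} * 'rV[K]_2 * 'rV[K]_2 :=
  (line t, vec t 0, vec t 1).

Fact line_mem (t : totO) (u v : subvs_of (line t)) :
  exists e c d, vsval u = c *: e /\ vsval v = d *: e.
Proof.
set L := line t; have dL : \dim L = 1%N := eqP (dim_line t).
have nzL : L != 0%VS by rewrite -dimv_eq0 dL.
have eL : (<[vpick L]> = L)%VS.
  apply/eqP; rewrite eqEdim -memvE memv_pick dL dim_vline.
  by rewrite vpick0 nzL.
have /vlineP[c uE] : vsval u \in <[vpick L]>%VS by rewrite eL subvsP.
have /vlineP[d vE] : vsval v \in <[vpick L]>%VS by rewrite eL subvsP.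
by exists (vpick L), c, d.
Qed.

Fact line_parallel (t : totO) (u v : subvs_of (line t)) (j k : 'I_2) :
  vsval u 0 j * vsval v 0 k = vsval u 0 k * vsval v 0 j.
Proof.
have [e [c [d [-> ->]]]] := line_mem u v.
by rewrite !mxE mulrACA [e 0 j * _]mulrC mulrACA.
Qed.

Fact line_parallel_scale (t : totO) (u v : subvs_of (line t)) (j : 'I_2) :
  vsval u 0 j *: v = vsval v 0 j *: u.
Proof.
have [e [c [d [uE vE]]]] := line_mem u v.
apply: subvs_inj; rewrite !linearZ /= uE vE !mxE !scalerA.
by rewrite mulrAC [d * _ * _]mulrAC [c * d]mulrC.
Qed.

Fact det_vec (t : totO) :
  vec t 0 0 0 * vec t 1 0 1 - vec t 0 0 1 * vec t 1 0 0 = 0.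
Proof. by rewrite line_parallel subrr. Qed.

Fact det_vec_plus (t : totO) :
  vec t 0 0 0 * vec t 1 0 1 - vec t 1 0 0 * vec t 0 0 1 = 0.
Proof. by rewrite [vec t 1 0 0 * _]mulrC det_vec. Qed.

(* Y and its flop are both isomorphic to the total space of O(-1) (+) O(-1);
   they differ by their maps to X.  Over X, Y is the resolution on which
   [x : z] = [w : y] extends to a map to P^1, and its flop the one on which
   [x : w] = [z : y] does, so that f^+ is f followed by the involution of X
   which swaps z and w. *)
Definition Y := totO.
Definition Yplus := totO.

Definition f_Y (p : Y) : conifold :=
  @Conifold (vec p 0 0 0) (vec p 1 0 1) (vec p 0 0 1) (vec p 1 0 0)
    (det_vec p).

Definition f_Yplus (p : Yplus) : conifold :=
  @Conifold (vec p 0 0 0) (vec p 1 0 1) (vec p 1 0 0) (vec p 0 0 1)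
    (det_vec_plus p).

Definition scalar_hom (E : vectType K) (u : E) : 'Hom(K^o, E) :=
  linfun (fun c : K^o => (c : K) *: u).

Definition coord_hom (L : {vspace 'rV[K]_2}) (i : 'I_2) :
    'Hom(subvs_of L, K^o) :=
  linfun (fun l : subvs_of L => vsval l 0 i : K^o).

Fact scalar_homE (E : vectType K) (u : E) (c : K^o) :
  scalar_hom u c = (c : K) *: u.
Proof.
have lin : linear (fun c : K^o => (c : K) *: u).
  by move=> k x y; rewrite scalerDl scalerA.
pose B := GRing.isLinear.Build K K^o E _ (fun c : K^o => (c : K) *: u) lin.
pose F : {linear K^o -> E} := HB.pack (fun c : K^o => (c : K) *: u) B.
by rewrite /scalar_hom (lfunE F).
Qed.

Fact coord_homE (L : {vspace 'rV[K]_2}) (i : 'I_2) (l : subvs_of L) :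
  coord_hom L i l = vsval l 0 i.
Proof.
have lin : linear (fun l : subvs_of L => vsval l 0 i : K^o).
  by move=> k x y; rewrite linearP /= !mxE.
pose B := GRing.isLinear.Build K (subvs_of L) K^o _
  (fun l : subvs_of L => vsval l 0 i : K^o) lin.
pose F : {linear subvs_of L -> K^o} :=
  HB.pack (fun l : subvs_of L => vsval l 0 i : K^o) B.
by rewrite /coord_hom (lfunE F).
Qed.

Fact tot_rel_scalar (t : totO) (j : 'I_2) :
  (scalar_hom (sec t 0) \o coord_hom (line t) j \o scalar_hom (sec t 1)
   = scalar_hom (sec t 1) \o coord_hom (line t) j \o scalar_hom (sec t 0))%VF.
Proof.
apply/lfunP=> c; rewrite !comp_lfunE !scalar_homE !coord_homE !linearZ /= !mxE.
by rewrite -!scalerA line_parallel_scale.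
Qed.

Fact tot_rel_coord (t : totO) (i : 'I_2) :
  (coord_hom (line t) 0 \o scalar_hom (sec t i) \o coord_hom (line t) 1
   = coord_hom (line t) 1 \o scalar_hom (sec t i) \o coord_hom (line t) 0)%VF.
Proof.
apply/lfunP=> l; rewrite !comp_lfunE !coord_homE !scalar_homE.
by rewrite !linearZ /= !mxE line_parallel.
Qed.

(* The fibre at p of the tautological family of A-modules on Y.  Its
   underlying bundles are O at the vertex 0 and O(-1) at the vertex 1; b_1, b_2
   are the coordinates of the inclusion of O(-1) in O^2, and a_1, a_2 are the
   two tautological sections of O(-1). *)
Definition taut_Y (p : Y) : conifold_module K :=
  @ConifoldModule K K^o (subvs_of (line p))
    (fun i => scalar_hom (sec p i)) (fun j => coord_hom (line p) j)
    (tot_rel_scalar p) (tot_rel_coord p).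

(* On the flop, O(-1) is at the vertex 0 and the roles of a and b are
   exchanged. *)
Definition taut_Yplus (p : Yplus) : conifold_module K :=
  @ConifoldModule K (subvs_of (line p)) K^o
    (fun i => coord_hom (line p) i) (fun j => scalar_hom (sec p j))
    (tot_rel_coord p) (tot_rel_scalar p).

Fact rep11_rel (f g : 'rV[K]_2) (j : 'I_2) :
  (scalar_hom (f 0 0 : K^o) \o scalar_hom (g 0 j : K^o)
     \o scalar_hom (f 0 1 : K^o)
   = scalar_hom (f 0 1 : K^o) \o scalar_hom (g 0 j : K^o)
     \o scalar_hom (f 0 0 : K^o))%VF.
Proof.
apply/lfunP=> c; rewrite !comp_lfunE !scalar_homE /=.
by rewrite /GRing.scale /= mulrAC [RHS]mulrAC [in LHS](mulrAC c).
Qed.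

Definition rep11 (a b : 'rV[K]_2) : conifold_module K :=
  @ConifoldModule K K^o K^o
    (fun i => scalar_hom (a 0 i : K^o)) (fun j => scalar_hom (b 0 j : K^o))
    (rep11_rel a b) (rep11_rel b a).

(* The classifying maps (a, b) |-> ([b_1 : b_2], a_1 b, a_2 b) of Y and
   (a, b) |-> ([a_1 : a_2], b_1 a, b_2 a) of its flop, in the coordinates given
   by [coords]. *)
Definition class_Y (a b : 'rV[K]_2) := (<[b]>%VS, a 0 0 *: b, a 0 1 *: b).
Definition class_Yplus (a b : 'rV[K]_2) := (<[a]>%VS, b 0 0 *: a, b 0 1 *: a).

(* The coordinate ring of X is the centre of A, the functions x, y, z, w being
   the sums of a_1 b_1, a_2 b_2, a_1 b_2, a_2 b_1 respectively with the reversed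
   products; [W] lies over [q] if they act as the coordinates of [q]. *)
Definition lies_over W (q : conifold) : Prop :=
  let act i j c :=
    (arr_a W i \o arr_b W j = c *: \1)%VF /\
    (arr_b W j \o arr_a W i = c *: \1)%VF in
  [/\ act 0 0 (cx q), act 1 1 (cy q), act 0 1 (cz q) & act 1 0 (cw q)].

(* [M], with structure map [f] to X, parameterizes the stable modules of
   dimension vector (1, 1) by means of the family [T]:
   - the fibres of [T] represent each isomorphism class exactly once;
   - the resulting identification is one over X;
   - its inverse is the morphism [cl] on the space of representations on
     (K, K), so that it identifies varieties and not only sets of points. *)
Definition parameterizes (R : realType) (zeta : 'rV[R]_2) (M : Type)
    (f : M -> conifold) (T : M -> conifold_module K)
    (coordsM : M -> {vspace 'rV[K]_2} * 'rV[K]_2 * 'rV[K]_2)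
    (cl : 'rV[K]_2 -> 'rV[K]_2 -> {vspace 'rV[K]_2} * 'rV[K]_2 * 'rV[K]_2)
    : Prop :=
  [/\ forall p, stable zeta (T p) /\ dim_vector (T p) = (1, 1)%N,
      forall W, stable zeta W -> dim_vector W = (1, 1)%N ->
        exists! p, module_iso W (T p),
      forall p, lies_over (T p) (f p)
    & forall a b p, module_iso (rep11 a b) (T p) <-> coordsM p = cl a b].

Definition parameterized_by_Y (R : realType) (zeta : 'rV[R]_2) : Prop :=
  parameterizes zeta f_Y taut_Y coords class_Y.

Definition parameterized_by_Yplus (R : realType) (zeta : 'rV[R]_2) : Prop :=
  parameterizes zeta f_Yplus taut_Yplus coords class_Yplus.

(* No isomorphism class occurs twice in the list formed by [P m] for 1 <= m,
   the modules of dimension vector (1, 1), and [N m] for 0 <= m. *)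
Definition irredundant (P N : nat -> conifold_module K) : Prop :=
  [/\ forall m n, (1 <= m)%N -> (1 <= n)%N -> module_iso (P m) (P n) -> m = n,
      forall m n, module_iso (N m) (N n) -> m = n,
      forall m n, (1 <= m)%N -> ~ module_iso (P m) (N n),
      forall m, (1 <= m)%N -> dim_vector (P m) <> (1, 1)%N
    & forall m, dim_vector (N m) <> (1, 1)%N].

End Modules.

Arguments Cminus_plus : clear implicits.
Arguments Cminus_minus : clear implicits.
Arguments Cplus_plus : clear implicits.
Arguments Cplus_minus : clear implicits.
Arguments parameterized_by_Y K {R} zeta.
Arguments parameterized_by_Yplus K {R} zeta.

(* Main.v *)
Require Import Defs.
From HB Require Import structures.
From mathcomp Require Import all_boot all_order all_algebra.
From mathcomp Require Import reals complex.
From mathcomp Require Import zify ring.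

(* Exchanging the two vertices turns case (2) into case (1), so let
   zeta_0 < zeta_1; then stability says that [dim U1 * dim W0 < dim W1 * dim U0]
   for the nonzero proper submodules [U].  The elements a_i b_j + b_j a_i are
   central, hence act on a stable module by scalars c_ij, by Schur's lemma.
   - If some c_ij is nonzero, any u <> 0 in W0 spans with a_i u a submodule of
     dimension (1, 1), which must be everything.
   - If all c_ij vanish, (0, im a) is a submodule, so a = 0 and W is a
     representation (b_1, b_2) of the Kronecker quiver.  If dim W0 = dim W1, some
     b_2 - c b_1 is singular, which yields a submodule that forces dimension
     (1, 1).  Otherwise a dimension count gives a nonzero morphism between W
     and a C^-_+(m) or C^-_-(m) whose slope is on the wrong side, and Schur's
     lemma makes it an isomorphism. *)

Set Implicit Arguments.
Unset Strict Implicit.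
Unset Printing Implicit Defensive.

Import Order.TTheory GRing.Theory Num.Theory.
Import passmx.
Local Open Scope ring_scope.

(** * Linear bijections and dimensions of images *)

Lemma ord2P (i : 'I_2) : i = 0 \/ i = 1.
Proof. by case: i => [[|[|//]] ?]; [left|right]; apply: val_inj. Qed.

Lemma lfun_bij (K : fieldType) (E F : vectType K) (f : 'Hom(E, F)) :
  lker f = 0%VS -> limg f = fullv -> bijective f.
Proof.
move=> k0 im; exists (f^-1)%VF; first by apply: lker0_lfunK; rewrite k0.
by move=> y; apply: limg_lfunVK; rewrite im memvf.
Qed.

Lemma lker_bij (K : fieldType) (E F : vectType K) (f : 'Hom(E, F)) :
  bijective f -> lker f == 0%VS.
Proof. by move/bij_inj/lker0P. Qed.

Lemma limg_bij (K : fieldType) (E F : vectType K) (f : 'Hom(E, F)) :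
  bijective f -> limg f = fullv.
Proof.
case=> g fK gK; apply/eqP; rewrite eqEsubv subvf; apply/subvP=> y _.
by rewrite -(gK y) memv_img ?memvf.
Qed.

Lemma dim_img_inj (K : fieldType) (E F : vectType K) (f : 'Hom(E, F)) U :
  lker f == 0%VS -> \dim (f @: U) = \dim U.
Proof. by move/eqP=> k0; apply: limg_dim_eq; rewrite k0 capv0. Qed.

Lemma dim_bij (K : fieldType) (E F : vectType K) (f : 'Hom(E, F)) :
  bijective f -> \dim {:E} = \dim {:F}.
Proof. by move=> fb; rewrite -(limg_bij fb) dim_img_inj ?lker_bij. Qed.

Lemma lfun_inv_bij (K : fieldType) (E F : vectType K) (f : 'Hom(E, F)) :
  bijective f -> bijective (f^-1)%VF.
Proof.
move=> fb; exists f; last exact: lker0_lfunK (lker_bij fb).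
by move=> y; apply: limg_lfunVK; rewrite limg_bij ?memvf.
Qed.

Lemma dim_fullv (K : fieldType) (E : vectType K) (U : {vspace E}) :
  (\dim {:E} <= \dim U)%N -> U = fullv.
Proof. by move=> h; apply/eqP; rewrite eqEdim subvf. Qed.

(** * Comparison of slopes as an inequality between natural numbers *)

Section Slopes.
Variables (R : realType) (zeta : 'rV[R]_2).

(** After clearing denominators, the difference of the two sides factors as [(zeta 0 1 - zeta 0 0) *
    (d.2 * e.1 - e.2 * d.1)], so only the sign of the first factor matters. *)
Lemma slope_lt (d e : nat * nat) : zeta 0 0 < zeta 0 1 ->
    (0 < d.1 + d.2)%N -> (0 < e.1 + e.2)%N ->
  (slope zeta d < slope zeta e) = (d.2 * e.1 < e.2 * d.1)%N.
Proof.
move=> zlt d0 e0; rewrite /slope ltr_pdivrMr ?ltr0n // mulrAC.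
rewrite ltr_pdivlMr ?ltr0n // -(ltr_nat R) -[LHS]subr_lt0 -[RHS]subr_lt0 !natrM !natrD.
rewrite -[RHS](pmulr_rlt0 _ (_ : 0 < zeta 0 1 - zeta 0 0)) ?subr_gt0 //.
apply: (congr1 (fun x : R => x < 0)); ring.
Qed.

Lemma slope_gt (d e : nat * nat) : zeta 0 1 < zeta 0 0 ->
    (0 < d.1 + d.2)%N -> (0 < e.1 + e.2)%N ->
  (slope zeta d < slope zeta e) = (d.1 * e.2 < e.1 * d.2)%N.
Proof.
move=> zlt d0 e0; rewrite /slope ltr_pdivrMr ?ltr0n // mulrAC.
rewrite ltr_pdivlMr ?ltr0n // -(ltr_nat R) -[LHS]subr_lt0 -[RHS]subr_lt0 !natrM !natrD.
rewrite -[RHS](pmulr_rlt0 _ (_ : 0 < zeta 0 0 - zeta 0 1)) ?subr_gt0 //.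
apply: (congr1 (fun x : R => x < 0)); ring.
Qed.

End Slopes.

(** * Stability freed of the real parameter, and Schur's lemma *)

Section Stability.
Variable K : fieldType.
Implicit Types V W : conifold_module K.

Definition swap W : conifold_module K :=
  @ConifoldModule K (sp1 W) (sp0 W) (arr_b W) (arr_a W) (@rel_b K W) (@rel_a K W).

(** This is stability for any [zeta] with [zeta 0 0 < zeta 0 1], and, after [swap], for any [zeta]
    with the opposite inequality. Comparing slopes amounts to comparing the ratios of the dimension
    at vertex 1 to that at vertex 0. *)
Definition ratio_stable W : Prop :=
  dim_vector W <> (0, 0)%N /\
  forall (U0 : {vspace sp0 W}) (U1 : {vspace sp1 W}),
    submodule U0 U1 ->
    (U0, U1) <> (0%VS, 0%VS) ->
    (U0, U1) <> (fullv, fullv) ->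
    (\dim U1 * \dim {:sp0 W} < \dim {:sp1 W} * \dim U0)%N.

Lemma dim_pair_gt0 W (U0 : {vspace sp0 W}) (U1 : {vspace sp1 W}) :
  (U0, U1) <> (0%VS, 0%VS) <-> (0 < \dim U0 + \dim U1)%N.
Proof.
rewrite lt0n addn_eq0 !dimv_eq0; split=> [U_neq0|].
  by apply/negP=> /andP[/eqP U00 /eqP U10]; rewrite U00 U10 in U_neq0.
by move=> /negP h [U00 U10]; apply: h; rewrite U00 U10 !eqxx.
Qed.

Lemma dim_vector_gt0 W :
  dim_vector W <> (0, 0)%N <-> (0 < \dim {:sp0 W} + \dim {:sp1 W})%N.
Proof.
rewrite /dim_vector lt0n addn_eq0; split=> [dW|/negP h [d0 d1]].
  by apply/negP=> /andP[/eqP d0 /eqP d1]; rewrite d0 d1 in dW.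
by apply: h; rewrite d0 d1.
Qed.

Section Real.
Variables (R : realType) (zeta : 'rV[R]_2).

Lemma stable_ratio W : zeta 0 0 < zeta 0 1 ->
  stable zeta W <-> ratio_stable W.
Proof.
move=> zlt; split=> -[/[dup] dW /dim_vector_gt0 dWp WP];
  split=> // U0 U1 sU nzU nfU; have := WP U0 U1 sU nzU nfU;
  by rewrite slope_lt //=; apply/dim_pair_gt0.
Qed.

Lemma stable_ratio_swap W : zeta 0 1 < zeta 0 0 ->
  stable zeta W <-> ratio_stable (swap W).
Proof.
move=> zlt; split=> -[dW WP].
  have /dim_vector_gt0 dWp := dW; split=> [|U1 U0 sU nzU nfU].
    by apply/dim_vector_gt0; rewrite addnC.
  have /dim_pair_gt0 nzUp : (U0, U1) <> (0%VS, 0%VS).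
    by move=> [e0 e1]; apply: nzU; rewrite e0 e1.
  have := WP U0 U1; rewrite slope_gt //=; apply=> //.
  - by move=> i; have [] := sU i.
  - exact/dim_pair_gt0.
  - by move=> [e0 e1]; apply: nfU; rewrite e0 e1.
have /dim_vector_gt0 dWp := dW; split=> [|U0 U1 sU nzU nfU].
  by apply/dim_vector_gt0; rewrite addnC.
have /dim_pair_gt0 nzUp := nzU; rewrite slope_gt //=; last by rewrite addnC.
apply: (WP U1 U0).
- by move=> i; have [] := sU i.
- by move=> [e0 e1]; apply: nzU; rewrite e0 e1.
- by move=> [e0 e1]; apply: nfU; rewrite e0 e1.
Qed.

End Real.

Lemma module_iso_sym V W : module_iso V W -> module_iso W V.
Proof.
case=> p0 [p1 [b0 b1 ca cb]].
exists (p0^-1)%VF, (p1^-1)%VF; split; try exact: lfun_inv_bij.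
  move=> i; apply/lfunP=> x; rewrite !comp_lfunE /=.
  apply: (bij_inj b1); rewrite limg_lfunVK ?limg_bij ?memvf //.
  have /lfunP/(_ (p0^-1%VF x)) := ca i; rewrite !comp_lfunE => ->.
  by rewrite limg_lfunVK ?limg_bij ?memvf.
move=> i; apply/lfunP=> x; rewrite !comp_lfunE /=.
apply: (bij_inj b0); rewrite limg_lfunVK ?limg_bij ?memvf //.
have /lfunP/(_ (p1^-1%VF x)) := cb i; rewrite !comp_lfunE => ->.
by rewrite limg_lfunVK ?limg_bij ?memvf.
Qed.

Lemma module_iso_trans V W X :
  module_iso V W -> module_iso W X -> module_iso V X.
Proof.
case=> p0 [p1 [b0 b1 ca cb]] [q0 [q1 [c0 c1 da db]]].
exists (q0 \o p0)%VF, (q1 \o p1)%VF; split.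
- by apply: eq_bij (bij_comp c0 b0) _ _ => x; rewrite comp_lfunE.
- by apply: eq_bij (bij_comp c1 b1) _ _ => x; rewrite comp_lfunE.
- by move=> i; rewrite -comp_lfunA ca comp_lfunA da comp_lfunA.
- by move=> i; rewrite -comp_lfunA cb comp_lfunA db comp_lfunA.
Qed.

Lemma module_iso_swap V W : module_iso V W <-> module_iso (swap V) (swap W).
Proof. by split=> -[p0 [p1 [? ? ? ?]]]; exists p1, p0. Qed.

Lemma module_iso_dim V W : module_iso V W -> dim_vector V = dim_vector W.
Proof. by case=> p0 [p1 [b0 b1 _ _]]; rewrite /dim_vector (dim_bij b0) (dim_bij b1). Qed.

Lemma ratio_stable_iso V W : module_iso V W -> ratio_stable W -> ratio_stable V.
Proof.
move=> VW [dW WP]; have dVW := module_iso_dim VW; split; first by rewrite dVW.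
case: dVW VW => d0 d1 [p0 [p1 [b0 b1 ca cb]]] U0 U1 sU nzU nfU.
have := WP (p0 @: U0)%VS (p1 @: U1)%VS.
rewrite !dim_img_inj ?lker_bij // -d0 -d1; apply.
- move=> i; have [sa sb] := sU i.
  by rewrite -!limg_comp -ca -cb !limg_comp !limgS.
- by apply/dim_pair_gt0; rewrite !dim_img_inj ?lker_bij //; apply/dim_pair_gt0.
- move=> [e0 e1]; apply: nfU; congr pair; apply: dim_fullv.
    by rewrite d0 -e0 dim_img_inj ?lker_bij.
  by rewrite d1 -e1 dim_img_inj ?lker_bij.
Qed.

Lemma ratio_stable_sub W (U0 : {vspace sp0 W}) (U1 : {vspace sp1 W}) :
    ratio_stable W -> submodule U0 U1 -> (U0, U1) <> (0%VS, 0%VS) ->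
  (\dim U1 * \dim {:sp0 W} < \dim {:sp1 W} * \dim U0)%N \/
  (U0 = fullv /\ U1 = fullv).
Proof.
move=> [_ WP] sU nzU; have [/andP[/eqP -> /eqP ->]|] := boolP ((U0 == fullv) && (U1 == fullv)).
  by right.
by move=> nfU; left; apply: WP => //; apply/eqP; rewrite xpair_eqE.
Qed.

(* The image of the morphism is both a quotient of [V] and a submodule of [W],
   so stability leaves room only for an isomorphism. *)
Lemma ratio_stable_schur V W (p0 : 'Hom(sp0 V, sp0 W)) (p1 : 'Hom(sp1 V, sp1 W)) :
    ratio_stable V -> ratio_stable W ->
    (\dim {:sp1 W} * \dim {:sp0 V} <= \dim {:sp1 V} * \dim {:sp0 W})%N ->
    (forall i, (p1 \o arr_a V i = arr_a W i \o p0)%VF) ->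
    (forall i, (p0 \o arr_b V i = arr_b W i \o p1)%VF) ->
    (p0, p1) <> (0, 0) -> bijective p0 /\ bijective p1.
Proof.
move=> sV sW VW ca cb nz.
have k0 := limg_ker_dim p0 fullv; have k1 := limg_ker_dim p1 fullv.
rewrite !capfv in k0 k1.
have sk : submodule (lker p0) (lker p1).
  move=> i; rewrite !lkerE -!limg_comp ca cb !limg_comp.
  by split; rewrite (eqP (_ : _ @: lker _ == 0)%VS) ?limg0 -?lkerE ?subvv.
have si : submodule (limg p0) (limg p1).
  by move=> i; rewrite -!limg_comp -ca -cb !limg_comp !limgS ?subvf.
have nzi : (limg p0, limg p1) <> (0, 0)%VS.
  move=> [i0 i1]; apply: nz; congr pair; apply/lfunP=> x; rewrite lfunE /=; apply/eqP.
    by rewrite -memv0 -i0 memv_img ?memvf.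
  by rewrite -memv0 -i1 memv_img ?memvf.
have /dim_pair_gt0 di := nzi.
have /dim_vector_gt0 dV := sV.1; have /dim_vector_gt0 dW := sW.1.
have hi := ratio_stable_sub sW si nzi.
have [kz|] := boolP ((lker p0 == 0) && (lker p1 == 0))%VS; last first.
  move=> nk.
  have nzk : (lker p0, lker p1) <> (0, 0)%VS by apply/eqP; rewrite xpair_eqE.
  have [hk|[f0 f1]] := ratio_stable_sub sV sk nzk; last first.
    by move: k0 k1; rewrite f0 f1; lia.
  case: hi => [hi|[f0 f1]]; last by move: k0 k1; rewrite f0 f1; nia.
  (* The kernel is a proper submodule of smaller slope than [V], so the image, being the quotient,
     has larger slope than [V]. As a proper submodule of [W] it has smaller slope than [W], whose
     slope is at most that of [V]: a cycle. The inequalities are chained below after multiplication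
     by [i0], [w0] and [c0 + i0]. *)
  exfalso; move: hi hk VW; rewrite -k0 -k1; clear.
  set i0 := \dim (limg p0); set i1 := \dim (limg p1).
  set c0 := \dim (lker p0); set c1 := \dim (lker p1).
  set w0 := \dim {:sp0 W}; set w1 := \dim {:sp1 W}.
  move=> hi hk.
  have [->|w0_gt0] := posnP w0; first by nia.
  have [|v0_gt0] := posnP (c0 + i0); first by nia.
  move=> VW.
  have : (i0 * (w1 * (c0 + i0)) <= i0 * ((c1 + i1) * w0))%N by rewrite leq_mul2l VW orbT.
  have : (w0 * (i0 * (c1 + i1)) < w0 * (i1 * (c0 + i0)))%N by rewrite ltn_mul2l w0_gt0; lia.
  have : ((c0 + i0) * (i1 * w0) < (c0 + i0) * (w1 * i0))%N by rewrite ltn_mul2l v0_gt0.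
  nia.
case/andP: kz => /eqP kz0 /eqP kz1.
(* The morphism is now injective, so its image has the dimensions of [V]; a proper image would have
   smaller slope than [W], hence than [V]. *)
case: hi => [hi|[f0 f1]]; last by split; apply: lfun_bij.
exfalso; move: k0 k1; rewrite kz0 kz1 !dimv0 !add0n => k0 k1.
by move: hi VW; rewrite k0 k1; lia.
Qed.

End Stability.

Lemma leigenvalue_closed (K : closedFieldType) (E : vectType K) (f : 'End(E)) :
  (0 < \dim {:E})%N -> exists c v, v != 0 /\ f v = c *: v.
Proof.
move=> dE; have eE := vbasisP {:E}.
have [c rc] : exists c, root (char_poly (mxof (vbasis {:E}) (vbasis {:E}) f)) c.
  by apply/closed_rootP; rewrite size_char_poly eqSS -lt0n.
move: rc; rewrite -eigenvalue_root_char /eigenvalue.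
rewrite -(vsof_eq0 eE) -(leigenspaceE eE) -vpick0 => nz.
exists c, (vpick (leigenspace f c)); split=> //; apply/eqP.
have := memv_pick (leigenspace f c).
by rewrite memv_ker add_lfunE opp_lfunE scale_lfunE id_lfunE subr_eq0.
Qed.

(** * Representations of the Kronecker quiver: existence of morphisms, stability of the model
    modules *)

Section KroneckerModules.
Variable K : fieldType.
Implicit Types V W : conifold_module K.

(* Morphisms are the kernel of a linear map whose source and target have as
   dimensions the two sides of the inequality. *)
Lemma kronecker_hom V W :
    (forall i, arr_a V i = 0) -> (forall i, arr_a W i = 0) ->
    (2 * (\dim {:sp1 V} * \dim {:sp0 W}) <
       \dim {:sp0 V} * \dim {:sp0 W} + \dim {:sp1 V} * \dim {:sp1 W})%N ->
  exists (p0 : 'Hom(sp0 V, sp0 W)) (p1 : 'Hom(sp1 V, sp1 W)),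
    [/\ (p0, p1) <> (0, 0), forall i, (p1 \o arr_a V i = arr_a W i \o p0)%VF
      & forall i, (p0 \o arr_b V i = arr_b W i \o p1)%VF].
Proof.
move=> aV aW dVW.
pose H := ('Hom(sp0 V, sp0 W) * 'Hom(sp1 V, sp1 W))%type.
pose D := ('Hom(sp1 V, sp0 W) * 'Hom(sp1 V, sp0 W))%type.
pose psi i (p : H) := ((p.1 \o arr_b V i) - (arr_b W i \o p.2))%VF.
pose phi (p : H) : D := (psi 0 p, psi 1 p).
have psi_lin i : linear (psi i).
  move=> c p q; apply/lfunP=> x.
  rewrite /psi !(add_lfunE, opp_lfunE, scale_lfunE, comp_lfunE) /=.
  by rewrite linearP scalerBr opprD addrACA.
have phi_lin : linear phi by move=> c p q; rewrite /phi !psi_lin.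
pose F : {linear H -> D} := HB.pack phi (GRing.isLinear.Build K H D _ phi phi_lin).
have := limg_ker_dim (linfun F) fullv; rewrite capfv => dk.
have : lker (linfun F) != 0%VS.
  apply/eqP=> k0; rewrite k0 dimv0 add0n in dk.
  have := dimvS (subvf (limg (linfun F))); rewrite dk leqNgt => /negP; apply.
  by move: dVW; rewrite !dimvf mul2n -addnn.
move=> nzk; pose p := vpick (lker (linfun F)).
have nzp : p != 0 by rewrite /p vpick0.
have : p \in lker (linfun F) by exact: memv_pick.
rewrite memv_ker lfunE /= => /eqP [e0 e1].
exists p.1, p.2; split; first by move=> pz; move: nzp; rewrite [p]surjective_pairing pz eqxx.
  by move=> i; rewrite aV aW comp_lfun0l comp_lfun0r.
move=> i; apply/eqP; rewrite -subr_eq0; apply/eqP.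
by have [->|->] := ord2P i.
Qed.

(** Reading rows as polynomials makes iterated shifts into multiplications by powers of ['X]. The
    bound on [p + i] ensures that no coefficient is cut off. *)
Lemma rVpoly_kron_up p q (i : 'I_2) (v : 'rV[K]_p) : (p + i <= q)%N ->
  rVpoly (kron_up K p q i v) = 'X^i * rVpoly v.
Proof.
move=> piq; apply/polyP=> k; rewrite coefXnM !coef_rVpoly.
case: insubP => [k' kq kk'|]; last first.
  rewrite -leqNgt => qk; case: ltnP => // ik.
  by case: insubP => //= j; lia.
rewrite lfunE /= mxE; under eq_bigr => j _ do rewrite mxE kk'.
case: ltnP => [ki|ik].
  by rewrite big1 // => j _; rewrite (_ : _ == _ = false) ?mulr0 //; lia.
case: insubP => [j jp jk|jp]; last first.
  by rewrite big1 // => j _; rewrite (_ : _ == _ = false) ?mulr0 //; have := ltn_ord j; lia.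
rewrite (bigD1 j) //= jk subnK // eqxx mulr1 big1 ?addr0 // => l /eqP lj.
rewrite (_ : _ == _ = false) ?mulr0 //; apply/eqP=> lik; apply: lj.
by apply: val_inj; rewrite jk -lik addnK.
Qed.

Lemma kron_downE m (i : 'I_2) (v : 'rV[K]_m.+1) (k : 'I_m) (j : 'I_m.+1) :
  j = (k + i)%N :> nat -> kron_down K m.+1 m i v 0 k = v 0 j.
Proof.
move=> jk; rewrite lfunE /= mxE (bigD1 j) //= mxE jk eqxx mulr1 big1 ?addr0 // => l /eqP lj.
rewrite mxE (_ : _ == _ = false) ?mulr0 //; apply/eqP=> lik; apply: lj.
by apply: val_inj; rewrite [LHS]lik -jk.
Qed.

(** In terms of polynomials, the first map is the inclusion and the second is multiplication by
    ['X]. If the dimension did not grow, [U0] would be the image of [U1] under the inclusion, so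
    [U1] would be closed under multiplication by ['X]. It would then contain ['X^m * u] for some
    [u != 0], although its elements have degree less than [m]. *)
Lemma kron_up_expand m (U0 : {vspace 'rV[K]_m.+1}) (U1 : {vspace 'rV[K]_m}) :
    (forall i, kron_up K m m.+1 i @: U1 <= U0)%VS -> U1 != 0%VS ->
  (\dim U1 < \dim U0)%N.
Proof.
move=> bU nzU1; have inj0 : lker (kron_up K m m.+1 0) == 0%VS.
  apply/lker0P=> u v /(congr1 rVpoly); rewrite !rVpoly_kron_up ?addn0 ?leqnSn // !mul1r.
  exact: (can_inj rVpolyK).
rewrite ltnNge; apply/negP=> le_u.
have bU1 : (kron_up K m m.+1 0 @: U1)%VS = U0.
  by apply/eqP; rewrite eqEdim bU dim_img_inj.
have [u uU nzu] : exists2 u, u \in U1 & u != 0.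
  by exists (vpick U1); rewrite ?memv_pick ?vpick0.
have /(_ m)[v vU vE] n : exists2 v, v \in U1 & rVpoly v = 'X^n * rVpoly u.
  elim: n => [|n [v vU vE]]; first by exists u; rewrite ?mul1r.
  have := memv_img (kron_up K m m.+1 1) vU => /(subvP (bU 1)).
  rewrite -bU1 => /memv_imgP[w wU /(congr1 rVpoly)].
  rewrite !rVpoly_kron_up ?addn0 ?addn1 // expr0 expr1 mul1r => wE.
  by exists w => //; rewrite -wE vE mulrA exprS.
have : (size (rVpoly v) <= m)%N by exact: size_poly.
have nzp : rVpoly u != 0.
  by apply: contra_neq nzu => u0; rewrite -[u]rVpolyK u0 linear0.
by rewrite vE size_monicM ?monicXn // size_polyXn; move: nzp; rewrite -size_poly_gt0; lia.
Qed.

(* [b_1] is injective on [U1] up to the last basis vector, so [U1] contains it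
   and [b_1 U1 = U0]; then [b_2] carries it back through all the others. *)
Lemma kron_down_expand m (U0 : {vspace 'rV[K]_m}) (U1 : {vspace 'rV[K]_m.+1}) :
    (forall i, kron_down K m.+1 m i @: U1 <= U0)%VS -> (\dim U0 < \dim U1)%N ->
  U0 = fullv /\ U1 = fullv.
Proof.
set b := kron_down K m.+1 m => bU lt_u; pose b0 := b 0.
pose e : 'rV[K]_m.+1 := delta_mx 0 ord_max.
have ker_b : (\dim (lker b0) <= 1)%N.
  rewrite (leq_trans (dimvS (_ : _ <= <[e]>)%VS)) ?dim_vline ?leq_b1 //.
  apply/subvP=> v; rewrite memv_ker => /eqP bv0; apply/vlineP; exists (v 0 ord_max).
  apply/rowP=> k; rewrite !mxE eqxx /=; have [->|nk] := eqVneq k ord_max; first by rewrite mulr1.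
  have km : (k < m)%N by rewrite ltn_neqAle -ltnS ltn_ord andbT.
  rewrite mulr0; have := congr1 (fun v => fun_of_matrix v 0 (Ordinal km)) bv0.
  by rewrite mxE (@kron_downE _ _ _ _ k) //= addn0.
have dU := limg_ker_dim b0 U1.
have dcap := dimvS (capvSr U1 (lker b0)).
have dbU : (\dim (b0 @: U1) <= \dim U0)%N := dimvS (bU 0).
(* The dimension of [U1] is that of its intersection with the kernel, at most 1, plus that of
   [b0 @: U1], at most that of [U0]. As it exceeds the dimension of [U0], both bounds are
   attained. *)
have kU : (lker b0 <= U1)%VS.
  apply/capv_idPr/eqP; rewrite eqEdim capvSr /=; apply: leq_trans ker_b _.
  by rewrite -(leq_add2r (\dim (b0 @: U1))) dU add1n (leq_ltn_trans dbU).
have bU1 : (b0 @: U1)%VS = U0.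
  apply/eqP; rewrite eqEdim (bU 0) /= -(leq_add2l 1%N) add1n (leq_trans lt_u) //.
  by rewrite -dU leq_add2r (leq_trans dcap).
(* By induction on [j], [U1] contains the span of the last [j + 1] basis vectors. In the induction
   step [w] is [v] shifted one place to the right, so that [b 1 w = b0 v] lies in [U0 = b0 @: U1],
   and [v] is in [U1] up to an element of the kernel. *)
have FU j (v : 'rV[K]_m.+1) : (forall k : 'I_m.+1, (k + j < m)%N -> v 0 k = 0) -> v \in U1.
  elim: j v => [|j IHj] v v0.
    apply: (subvP kU); rewrite memv_ker; apply/eqP/rowP=> k.
    rewrite (@kron_downE _ _ _ _ (widen_ord (leqnSn m) k)) ?mxE ?addn0 //.
    by apply: v0; rewrite addn0 /= ltn_ord.
  pose w : 'rV[K]_m.+1 := \row_k (if k == 0%N :> nat then 0 else v 0 (inord k.-1)).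
  have wU : w \in U1.
    apply: IHj => k kj; rewrite mxE; case: eqP => // /eqP; rewrite -lt0n => k_gt0.
    by apply: v0; rewrite inordK; lia.
  have bw : b 1 w = b0 v.
    apply/rowP=> k; rewrite [RHS](@kron_downE _ _ _ _ (widen_ord (leqnSn m) k)) ?addn0 //.
    rewrite (@kron_downE _ _ _ _ (lift ord0 k)) ?lift0 ?addn1 // mxE lift0 /=.
    by congr (v 0 _); apply: val_inj; rewrite /= inordK // ltnW // ltnS ltn_ord.
  have : b0 v \in U0 by rewrite -bw (subvP (bU 1)) // memv_img.
  rewrite -bU1 => /memv_imgP[v' v'U bv].
  by rewrite -(subrK v' v) memvD // (subvP kU) // memv_ker linearB /= bv subrr.
have fU1 : U1 = fullv.
  by apply/eqP; rewrite eqEsubv subvf; apply/subvP=> v _; apply: (FU m) => k; lia.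
have dU1 : \dim U1 = m.+1 by rewrite fU1 dimvf /dim /= mul1n.
split=> //; apply: dim_fullv; rewrite dimvf /dim /= mul1n -ltnS -dU1 -dU.
by rewrite (leq_add (leq_trans dcap ker_b) dbU).
Qed.

Lemma Cminus_plus_dim m : dim_vector (Cminus_plus K m) = (m, m.-1).
Proof. by rewrite /dim_vector !dimvf /dim /= !mul1n. Qed.

Lemma Cminus_minus_dim m : dim_vector (Cminus_minus K m) = (m, m.+1).
Proof. by rewrite /dim_vector !dimvf /dim /= !mul1n. Qed.

(** For dimensions [(m + 1, m)] and a submodule of dimensions [(u0, u1)] with [0 < u1 < m],
    expansion gives [u1 < u0], whence [u1 * (m + 1) < m * (u1 + 1) <= m * u0]. If [u1 = m],
    expansion makes the submodule full. *)
Lemma Cminus_plus_stable m : (1 <= m)%N -> ratio_stable (Cminus_plus K m).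
Proof.
case: m => // m _; have [d0 d1] := Cminus_plus_dim m.+1.
split=> [|U0 U1 sU nzU nfU]; first by rewrite Cminus_plus_dim.
rewrite d0 d1 /=.
(* Expansion says nothing about [U1 = 0]; there the inequality could only fail for [m = 0], when a
   nonzero [U0] is everything. *)
have [U10|nzU1] := eqVneq U1 0%VS.
  have /dim_pair_gt0 := nzU; rewrite U10 dimv0 addn0 => U0_gt0.
  rewrite mul0n muln_gt0 U0_gt0 andbT lt0n; apply/eqP=> m0.
  apply: nfU; rewrite U10; congr pair; apply: dim_fullv; rewrite ?d0 ?d1 /=.
    by rewrite [X in (X < _)%N]m0.
  by rewrite [X in (X <= _)%N]m0.
have lt_u : (\dim U1 < \dim U0)%N := kron_up_expand (fun i => (sU i).2) nzU1.
have U1m := dimvS (subvf U1); rewrite d1 /= in U1m.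
have [U1f|U1_lt] := leqP m (\dim U1); last first.
  by rewrite (leq_trans _ (leq_mul (leqnn m) lt_u)) // !mulnSr [(m * _)%N]mulnC ltn_add2l.
case: nfU; congr pair; apply: dim_fullv; rewrite ?d0 ?d1 //=; exact: leq_ltn_trans lt_u.
Qed.

(** A nonzero submodule with [u1 <= u0] has [u0 > 0], so [u1 * m <= m * u0 < (m + 1) * u0]; one with
    [u0 < u1] is full by expansion. *)
Lemma Cminus_minus_stable m : ratio_stable (Cminus_minus K m).
Proof.
have [d0 d1] := Cminus_minus_dim m.
split=> [|U0 U1 sU nzU nfU]; first by rewrite Cminus_minus_dim.
rewrite d0 d1 /=.
have [le_u|lt_u] := leqP (\dim U1) (\dim U0).
  have /dim_pair_gt0 U_gt0 := nzU; have U0_gt0 : (0 < \dim U0)%N by lia.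
  apply: leq_ltn_trans (_ : (m * \dim U0 < _)%N); first by rewrite mulnC leq_mul2l le_u orbT.
  by rewrite mulSn -[X in (X < _)%N]add0n ltn_add2r.
case: nfU; have [e0 e1] := kron_down_expand (fun i => (sU i).2) lt_u.
by congr pair.
Qed.

End KroneckerModules.

(** * Classification of the stable modules over an algebraically closed field *)

Lemma submodule_vline (K : fieldType) (W : conifold_module K) (u : sp0 W) (v : sp1 W) :
    (forall i, arr_a W i u \in <[v]>%VS) -> (forall i, arr_b W i v \in <[u]>%VS) ->
  submodule <[u]>%VS <[v]>%VS.
Proof. by move=> au bv i; rewrite !limg_line -!memvE. Qed.

(* The relations of the quiver say that [a_i b_j + b_j a_i] is central. *)
Lemma central_comm (K : fieldType) (W : conifold_module K) (i j k : 'I_2) :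
  (arr_a W k \o (arr_b W j \o arr_a W i) = arr_a W i \o arr_b W j \o arr_a W k)%VF
  /\ (arr_b W k \o (arr_a W i \o arr_b W j) = arr_b W j \o arr_a W i \o arr_b W k)%VF.
Proof.
rewrite !comp_lfunA.
by have [->|->] := ord2P i; have [->|->] := ord2P j; have [->|->] := ord2P k;
  rewrite ?rel_a ?rel_b.
Qed.

Section Classification.
Variable K : closedFieldType.
Implicit Types W : conifold_module K.

Lemma ratio_stable_central W : ratio_stable W -> forall i j, exists c : K,
  (arr_a W i \o arr_b W j = c *: \1)%VF /\ (arr_b W j \o arr_a W i = c *: \1)%VF.
Proof.
move=> sW i j.
pose z0 c := (arr_b W j \o arr_a W i - c *: \1)%VF.
pose z1 c := (arr_a W i \o arr_b W j - c *: \1)%VF.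
(* By centrality [(z0 c, z1 c)] is an endomorphism of [W], and Schur's lemma makes it zero at both
   vertices once it fails to be bijective at one. An eigenvalue at a vertex whose space is nonzero
   provides such a [c]. *)
suff [c hc] : exists c, ~ (bijective (z0 c) /\ bijective (z1 c)).
  have ca k : (z1 c \o arr_a W k = arr_a W k \o z0 c)%VF.
    rewrite comp_lfunDl comp_lfunDr (central_comm W i j k).1.
    by rewrite comp_lfunNl comp_lfunNr -comp_lfunZl -comp_lfunZr comp_lfun1l comp_lfun1r.
  have cb k : (z0 c \o arr_b W k = arr_b W k \o z1 c)%VF.
    rewrite comp_lfunDl comp_lfunDr (central_comm W i j k).2.
    by rewrite comp_lfunNl comp_lfunNr -comp_lfunZl -comp_lfunZr comp_lfun1l comp_lfun1r.
  have [/andP[/eqP e0 /eqP e1]|nz] := boolP ((z0 c == 0) && (z1 c == 0)).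
    by exists c; split; apply/eqP; rewrite -subr_eq0 ?[X in X == _]e0 ?[X in X == _]e1.
  case: hc; apply: (ratio_stable_schur sW sW _ ca cb) => //.
  by apply/eqP; rewrite xpair_eqE.
have not_bij (E : vectType K) (f : 'End(E)) v c :
  v != 0 -> f v = c *: v -> ~ bijective (f - c *: \1)%VF.
  move=> nzv fv /lker_bij/eqP k0; case/negP: nzv; rewrite -memv0 -k0 memv_ker.
  by rewrite add_lfunE opp_lfunE scale_lfunE id_lfunE fv subrr.
have /dim_vector_gt0 := sW.1; rewrite addn_gt0 => /orP[] d_gt0.
  have [c [v [nzv fv]]] := leigenvalue_closed (arr_b W j \o arr_a W i)%VF d_gt0.
  by exists c => -[/(not_bij _ _ _ _ nzv fv)].
have [c [v [nzv fv]]] := leigenvalue_closed (arr_a W i \o arr_b W j)%VF d_gt0.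
by exists c => -[_ /(not_bij _ _ _ _ nzv fv)].
Qed.

(** With equal dimensions at the two vertices, a proper submodule must be strictly larger at vertex
    0 than at vertex 1. This one is not, since [<[v]>] is a line and [<[u]>] at most a line, so it
    is all of [W]. *)
Lemma ratio_stable_vline W (u : sp0 W) (v : sp1 W) :
    ratio_stable W -> submodule <[u]>%VS <[v]>%VS -> v != 0 ->
    \dim {:sp0 W} = \dim {:sp1 W} ->
  dim_vector W = (1, 1)%N.
Proof.
move=> sW sU nzv eqd.
have nz : (<[u]>, <[v]>)%VS <> (0, 0)%VS.
  by apply/dim_pair_gt0; rewrite !dim_vline nzv addn1.
have [|[_ f1]] := ratio_stable_sub sW sU nz.
  by rewrite !dim_vline nzv mul1n eqd ltnNge -{2}[\dim _]muln1 leq_mul2l leq_b1 orbT.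
by rewrite /dim_vector eqd -f1 dim_vline nzv.
Qed.

Lemma ratio_stable_invertible W i j c :
    ratio_stable W -> c != 0 ->
    (arr_a W i \o arr_b W j = c *: \1)%VF -> (arr_b W j \o arr_a W i = c *: \1)%VF ->
  dim_vector W = (1, 1)%N.
Proof.
move=> sW nzc ab ba.
have inj (E F : vectType K) (f : 'Hom(E, F)) (g : 'Hom(F, E)) :
    (g \o f = c *: \1)%VF -> lker f == 0%VS.
  move=> gf; apply/lker0P=> x y /(congr1 g); rewrite -!comp_lfunE gf.
  by rewrite !scale_lfunE !id_lfunE; apply: scalerI.
have inja := inj _ _ _ _ ba; have injb := inj _ _ _ _ ab.
have eqd : \dim {:sp0 W} = \dim {:sp1 W}.
  apply/eqP; rewrite eqn_leq -{1}(dim_img_inj _ inja) dimvS ?subvf //.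
  by rewrite -{1}(dim_img_inj _ injb) dimvS ?subvf.
have nz0 : (0 < \dim {:sp0 W})%N.
  by have /dim_vector_gt0 := sW.1; rewrite -eqd addnn double_gt0.
pose u := vpick {:sp0 W}; have nzu : u != 0 by rewrite vpick0 -dimv_eq0 -lt0n.
have nzv : arr_a W i u != 0.
  by apply: contra_neq nzu => /(congr1 (arr_b W j)); rewrite -comp_lfunE ba
    scale_lfunE id_lfunE linear0 => /eqP; rewrite scaler_eq0 (negPf nzc) => /eqP.
have cen := ratio_stable_central sW.
apply: (ratio_stable_vline (u := u) sW _ nzv eqd); apply: submodule_vline => k; apply/vlineP.
  (* Since [b_j a_i] acts as [c], the vector [c *: a_k u] equals [a_k b_j a_i u], where [a_k b_j]
     acts as the scalar [d]. *)
  have [d [kd _]] := cen k j; exists (c^-1 * d); apply: (scalerI nzc).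
  rewrite scalerA mulrA divff // mul1r -[LHS]linearZ.
  transitivity ((arr_a W k \o (arr_b W j \o arr_a W i))%VF u).
    by rewrite ba comp_lfunE scale_lfunE id_lfunE.
  by rewrite comp_lfunA kd comp_lfunE scale_lfunE id_lfunE.
have [d [_ kd]] := cen i k; exists d.
by rewrite -comp_lfunE kd scale_lfunE id_lfunE.
Qed.

(** A nonzero submodule concentrated at vertex 1 violates the strict inequality of stability unless
    it is all of [W]; in that case the space at vertex 0 is zero and the maps out of it vanish. *)
Lemma ratio_stable_nilpotent W : ratio_stable W ->
  (forall i j, arr_a W i \o arr_b W j = 0 /\ arr_b W j \o arr_a W i = 0)%VF ->
  forall i, arr_a W i = 0.
Proof.
move=> sW cz i; apply/eqP/negPn/negP=> nza.
pose U : {vspace sp1 W} := (limg (arr_a W 0%R) + limg (arr_a W 1%R))%VS.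
have aU k : (limg (arr_a W k) <= U)%VS.
  have [->|->] := ord2P k.
    exact: addvSl.
  exact: addvSr.
have sU : submodule 0%VS U.
  move=> k; rewrite limg0 sub0v limgD -!limg_comp !(cz _ _).2 !lim0g add0v.
  by rewrite subvv.
have /lfunPn[u nzu] := nza; rewrite zero_lfunE in nzu.
have nzU : U != 0%VS.
  apply: contra_neq nzu => U0; apply/eqP; rewrite -memv0 -U0.
  by apply: (subvP (aU i)); rewrite memv_img ?memvf.
have nzp : (0%VS : {vspace sp0 W}, U) <> (0%VS, 0%VS).
  by apply/eqP; rewrite xpair_eqE (negPf nzU) andbF.
have [|[f0 _]] := ratio_stable_sub sW sU nzp; first by rewrite dimv0 muln0.
by case/negP: nzu; have := memvf u; rewrite -f0 memv0 => /eqP ->; rewrite linear0.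
Qed.

(* The square pencil [f + t g] is singular at some [t], possibly infinite. *)
Lemma pencil_vline (E F : vectType K) (f g : 'Hom(E, F)) :
    (0 < \dim {:E})%N -> \dim {:F} = \dim {:E} ->
  exists u v, [/\ v != 0, f v \in <[u]>%VS & g v \in <[u]>%VS].
Proof.
move=> dE dF; have [k0|nzk] := eqVneq (lker f) 0%VS; last first.
  exists (g (vpick (lker f))), (vpick (lker f)); rewrite vpick0 nzk memv_line.
  by have := memv_pick (lker f); rewrite memv_ker => /eqP ->; rewrite mem0v.
have imf : limg f = fullv.
  by apply: dim_fullv; rewrite dF dim_img_inj ?k0.
have [c [v [nzv fv]]] := leigenvalue_closed (f^-1 \o g)%VF dE.
exists (f v), v; split=> //; first exact: memv_line.
apply/vlineP; exists c.
by rewrite -[RHS]linearZ /= -fv comp_lfunE limg_lfunVK // imf memvf.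
Qed.

(** The condition in [kronecker_hom] is positivity of the Euler form of the Kronecker quiver. Off
    the diagonal, [k] is chosen so that this form is positive while the source of the morphism has
    at least the slope of its target: the morphism goes from [W] to the model when [n < m], and from
    the model to [W] when [m < n]. *)
Lemma ratio_stable_kronecker W : ratio_stable W -> (forall i, arr_a W i = 0) ->
  [\/ exists2 m, (1 <= m)%N & module_iso W (Cminus_plus K m),
      dim_vector W = (1, 1)%N
    | exists m, module_iso W (Cminus_minus K m)].
Proof.
move=> sW a0.
have /dim_vector_gt0 := sW.1.
set m := \dim {:sp0 W}; set n := \dim {:sp1 W} => d_gt0.
case: (ltngtP n m) => [lt_nm|lt_mn|eq_nm].
- (* That is, [k / k.+1 <= n / m < k.+1 / k.+2]: the left inequality is the
     slope condition in Schur's lemma, the right one the dimension count. *)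
  pose k := (n %/ (m - n))%N; apply: Or31; exists k.+1 => //.
  have [d0 d1] := Cminus_plus_dim K k.+1.
  have k_lo : (k * (m - n) <= n)%N := leq_trunc_div _ _.
  have k_hi : (n < k.+1 * (m - n))%N by rewrite ltn_ceil // subn_gt0.
  have [||p0 [p1 [nz ca cb]]] := @kronecker_hom K W (Cminus_plus K k.+1) a0.
  + by [].
  + by rewrite d0 d1 /= -/m -/n; move: k_hi; rewrite -(ltn_add2r (k.+1 * n)); nia.
  have [b0 b1] : bijective p0 /\ bijective p1.
    apply: ratio_stable_schur ca cb nz => //; first exact: Cminus_plus_stable.
    by rewrite d0 d1 /= -/m -/n; nia.
  by exists p0, p1.
- (* Here [k.+2 / k.+1 < n / m <= k.+1 / k]. *)
  pose k := (m %/ (n - m))%N; apply: Or33; exists k.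
  have [d0 d1] := Cminus_minus_dim K k.
  have k_lo : (k * (n - m) <= m)%N := leq_trunc_div _ _.
  have k_hi : (m < k.+1 * (n - m))%N by rewrite ltn_ceil // subn_gt0.
  have [||p0 [p1 [nz ca cb]]] := @kronecker_hom K (Cminus_minus K k) W _ a0.
  + by [].
  + by rewrite d0 d1 /= -/m -/n; nia.
  have [b0 b1] : bijective p0 /\ bijective p1.
    apply: ratio_stable_schur ca cb nz => //; first exact: Cminus_minus_stable.
    by rewrite d0 d1 /= -/m -/n; nia.
  by apply: module_iso_sym; exists p0, p1.
- apply: Or32.
  have [|u [v [nzv fv gv]]] := pencil_vline (arr_b W 0) (arr_b W 1) _ (esym eq_nm).
    by rewrite -/n -double_gt0 -addnn {1}eq_nm.
  apply: (ratio_stable_vline (u := u) sW _ nzv (esym eq_nm)); apply: submodule_vline => i.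
    by rewrite a0 zero_lfunE mem0v.
  by have [->|->] := ord2P i.
Qed.

Lemma ratio_stable_cases W : ratio_stable W ->
  [\/ exists2 m, (1 <= m)%N & module_iso W (Cminus_plus K m),
      dim_vector W = (1, 1)%N
    | exists m, module_iso W (Cminus_minus K m)].
Proof.
move=> sW; have [d11|nd11] := eqVneq (dim_vector W) (1, 1)%N; first exact: Or32.
apply: (ratio_stable_kronecker sW); apply: ratio_stable_nilpotent => // i j.
have [c [ab ba]] := ratio_stable_central sW i j; rewrite ab ba.
have [->|nzc] := eqVneq c 0; first by rewrite !scale0r.
by case/eqP: nd11; apply: ratio_stable_invertible nzc ab ba.
Qed.

End Classification.

(** * Modules of dimension vector [(1, 1)] and the tautological family on [Y] *)

Lemma scaler_cancel (K : fieldType) (E : lmodType K) (v : E) :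
  v != 0 -> injective (fun c : K => c *: v).
Proof.
move=> nzv c d /eqP; rewrite -subr_eq0 -scalerBl scaler_eq0 (negPf nzv) orbF.
by rewrite subr_eq0 => /eqP.
Qed.

Section Parameterization.
Variable K : fieldType.
Implicit Types (W : conifold_module K) (p q : totO K) (a b : 'rV[K]_2).

Lemma taut_Y_dim p : dim_vector (taut_Y p) = (1, 1)%N.
Proof. by rewrite /dim_vector !dimvf /dim /= (eqP (dim_line p)). Qed.

(** The only possible destabilizing submodule is zero at vertex 0 and the whole line at vertex 1. It
    is excluded because the arrows [b] are the coordinates on the line, and these do not vanish
    together on a nonzero vector. *)
Lemma taut_Y_stable p : ratio_stable (taut_Y p).
Proof.
have [d0 d1] := taut_Y_dim p; split=> [|U0 U1 sU nzU nfU]; first by rewrite taut_Y_dim.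
rewrite d0 d1 muln1 mul1n.
have /dim_pair_gt0 U_gt0 := nzU.
have [U1_0|U1_gt0] := posnP (\dim U1); first by move: U_gt0; rewrite U1_0 addn0.
have U1f : U1 = fullv by apply: dim_fullv; rewrite d1.
have [U0_0|U0_gt0] := posnP (\dim U0); last first.
  by case: nfU; rewrite U1f; congr pair; apply: dim_fullv; rewrite d0.
move/eqP: U0_0; rewrite dimv_eq0 => /eqP U0_0.
have v0 (v : subvs_of (line p)) : v = 0.
  apply: val_inj; apply/rowP=> j; rewrite mxE /= -coord_homE.
  have : arr_b (taut_Y p) j v \in U0.
    by apply: (subvP (sU j).2); rewrite memv_img // U1f memvf.
  by rewrite U0_0 memv0 => /eqP.
have : \dim {:subvs_of (line p)} != 0%N by rewrite d1.
by rewrite dimv_eq0 -vpick0 [vpick _]v0 eqxx.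
Qed.

Lemma taut_Y_lies_over p : lies_over (taut_Y p) (f_Y p).
Proof.
have act i j : (arr_a (taut_Y p) i \o arr_b (taut_Y p) j = vec p i 0 j *: \1)%VF /\
    (arr_b (taut_Y p) j \o arr_a (taut_Y p) i = vec p i 0 j *: \1)%VF.
  split; apply/lfunP=> x; rewrite comp_lfunE scale_lfunE id_lfunE /=.
    by rewrite coord_homE scalar_homE; apply: line_parallel_scale.
  by rewrite scalar_homE coord_homE linearZ /= mxE mulrC.
by split; apply: act.
Qed.

Lemma coords_inj : injective (@coords K).
Proof.
(* The type of the sections depends on the line, so the equality of lines is eliminated before the
   sections are compared. *)
move=> [L dL s] [L' dL' s'] [] /= eL; case: _ / eL dL' s' => dL' s' e0 e1.
rewrite (bool_irrelevance dL dL'); congr TotO; apply/ffunP=> i.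
by apply: val_inj; have [->|->] := ord2P i.
Qed.

Lemma coords_surj a b : b != 0 -> exists p, coords p = class_Y a b.
Proof.
move=> nzb; have dL : \dim <[b]>%VS == 1%N by rewrite dim_vline nzb.
have bL i : a 0 i *: b \in <[b]>%VS by rewrite memvZ ?memv_line.
exists (TotO dL [ffun i => Subvs (bL i)]).
by rewrite /coords /vec /= !ffunE.
Qed.

(** An isomorphism is given by a scalar [s != 0] and a vector [l] of the line; compatibility with
    the arrows [b] reads [l = s *: b], and compatibility with the arrows [a] then says that the
    sections are the [a 0 i *: b]. Conversely, the identity at vertex 0 and [c |-> c *: b] at vertex
    1 form an isomorphism. *)
Lemma taut_Y_class a b p :
  module_iso (rep11 a b) (taut_Y p) <-> coords p = class_Y a b.
Proof.
split=> [[p0 [p1 [b0 b1 ca cb]]]|].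
  pose s : K := p0 (1 : K^o); pose l : subvs_of (line p) := p1 (1 : K^o).
  have p0E (c : K) : p0 (c : K^o) = c * s.
    by rewrite /s -[c in LHS]mulr1 -[_ * 1]/(c *: (1 : K^o)) linearZ.
  have p1E (c : K) : p1 (c : K^o) = c *: l.
    by rewrite /l -[c in LHS]mulr1 -[_ * 1]/(c *: (1 : K^o)) linearZ.
  have nzs : s != 0.
    apply/eqP=> s0; have := bij_inj b0 (_ : p0 (1 : K^o) = p0 (0 : K^o)).
    by rewrite !p0E s0 !mulr0 => /(_ erefl)/eqP; rewrite oner_eq0.
  have nzl : l != 0.
    apply/eqP=> l0; have := bij_inj b1 (_ : p1 (1 : K^o) = p1 (0 : K^o)).
    by rewrite !p1E l0 !scaler0 => /(_ erefl)/eqP; rewrite oner_eq0.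
  have lE : vsval l = s *: b.
    apply/rowP=> j; have /lfunP/(_ (1 : K^o)) := cb j.
    rewrite !comp_lfunE /= scalar_homE coord_homE -/l => <-.
    by rewrite -[_ *: _]/(1 * b 0 j) mul1r p0E mxE mulrC.
  have nzb : b != 0.
    by apply: contra_neq nzl => b0'; apply: val_inj; rewrite /= lE b0' scaler0.
  have secE i : vec p i = a 0 i *: b.
    apply: (scalerI nzs); rewrite scalerA mulrC -scalerA -lE.
    have /lfunP/(_ (1 : K^o)) := ca i; rewrite !comp_lfunE /= !scalar_homE.
    rewrite -[_ *: _]/(1 * a 0 i) mul1r p1E -/s => /(congr1 vsval).
    by rewrite !linearZ.
  rewrite /coords /class_Y !secE; congr (_, _, _); apply/esym/eqP.
  rewrite eqEdim (eqP (dim_line p)) dim_vline nzb andbT.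
  by rewrite -memvE -[b](scalerK nzs) -lE memvZ ?subvsP.
case=> eL e0 e1.
have bL : b \in line p by rewrite eL memv_line.
have nzb : b != 0 by have := dim_line p; rewrite eL dim_vline; case: (b != 0).
exists \1%VF, (scalar_hom (Subvs bL)); split.
- by exists id => x; rewrite id_lfunE.
- apply: lfun_bij.
    apply/eqP/lker0P=> c d /(congr1 vsval); rewrite !scalar_homE !linearZ /=.
    by move/(scaler_cancel nzb).
  apply/eqP; rewrite eqEsubv subvf; apply/subvP=> v _.
  have : vsval v \in <[b]>%VS by rewrite -eL subvsP.
  case/vlineP=> c vE; apply/memv_imgP; exists (c : K^o); first exact: memvf.
  by rewrite scalar_homE; apply: val_inj; rewrite [RHS]linearZ.
- move=> i; apply/lfunP=> c; rewrite !comp_lfunE /= !scalar_homE id_lfunE.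
  apply: val_inj; transitivity (c *: (a 0 i *: b)); first by rewrite scalerA.
  by rewrite [RHS]linearZ; congr (_ *: _); have [->|->] := ord2P i.
- move=> j; apply/lfunP=> c; rewrite !comp_lfunE /= !scalar_homE id_lfunE coord_homE.
  by rewrite linearZ /= mxE.
Qed.

Lemma dim1_rep11 W : dim_vector W = (1, 1)%N -> exists a b, module_iso W (rep11 a b).
Proof.
case=> d0 d1.
have basis (E : vectType K) : \dim {:E} = 1%N ->
    exists e : E, [/\ e != 0, bijective (scalar_hom e) & forall x, exists c, x = c *: e].
  move=> dE; pose e := vpick {:E}; have nze : e != 0 by rewrite vpick0 -dimv_eq0 dE.
  have fE : <[e]>%VS = fullv by apply: dim_fullv; rewrite dE dim_vline nze.
  have span x : exists c, x = c *: e by apply/vlineP; rewrite fE memvf.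
  exists e; split=> //; apply: lfun_bij.
    by apply/eqP/lker0P=> c d; rewrite !scalar_homE => /(scaler_cancel nze).
  apply/eqP; rewrite eqEsubv subvf; apply/subvP=> x _; have [c ->] := span x.
  by apply/memv_imgP; exists (c : K^o); rewrite ?memvf ?scalar_homE.
have [u [nzu bu spu]] := basis _ d0; have [v [nzv bv spv]] := basis _ d1.
have [a0 a0E] := spv (arr_a W 0 u); have [a1 a1E] := spv (arr_a W 1 u).
have [b0 b0E] := spu (arr_b W 0 v); have [b1 b1E] := spu (arr_b W 1 v).
exists (\row_i if i == 0 then a0 else a1), (\row_i if i == 0 then b0 else b1).
apply: module_iso_sym; exists (scalar_hom u), (scalar_hom v).
split=> // i; apply/lfunP=> c; rewrite !comp_lfunE /= !scalar_homE linearZ /= mxE.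
  transitivity (c *: ((if i == 0 then a0 else a1) *: v)); first by rewrite scalerA.
  by congr (_ *: _); have [->|->] := ord2P i; rewrite /= ?a0E ?a1E.
transitivity (c *: ((if i == 0 then b0 else b1) *: u)); first by rewrite scalerA.
by congr (_ *: _); have [->|->] := ord2P i; rewrite /= ?b0E ?b1E.
Qed.

(** On a model [rep11 a b], stability forces [b != 0], since otherwise the space at vertex 1 is a
    submodule by itself. Then [class_Y a b] is the coordinate triple of a point, and that point is
    unique by [coords_inj]. *)
Lemma ratio_stable_taut_Y W : ratio_stable W -> dim_vector W = (1, 1)%N ->
  exists! p, module_iso W (taut_Y p).
Proof.
move=> sW d11; have [a [b Wab]] := dim1_rep11 d11.
have abW := module_iso_sym Wab.
have nzb : b != 0.
  apply/eqP=> b0; have [_ sab] := ratio_stable_iso abW sW.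
  have dK : \dim {:K^o} = 1%N by rewrite dimvf.
  suff : (\dim {:K^o} * \dim {:K^o} < \dim {:K^o} * \dim (0%VS : {vspace K^o}))%N.
    by rewrite dimv0 muln0.
  apply: sab.
  - move=> i; rewrite limg0 sub0v b0 /= mxE; split=> //.
    apply/subvP=> _ /memv_imgP[c _ ->]; rewrite scalar_homE scaler0 mem0v //.
  - by move/(congr1 (fun U => \dim U.2)); rewrite /= dK dimv0.
  - by move/(congr1 (fun U => \dim U.1)); rewrite /= dK dimv0.
have [p pE] := coords_surj a nzb; exists p; split.
  by apply: module_iso_trans Wab _; apply/taut_Y_class.
move=> q Wq; apply: coords_inj; rewrite pE; apply/esym/taut_Y_class.
exact: module_iso_trans abW Wq.
Qed.

End Parameterization.

(** * Irredundancy and parameterization, with the second case obtained by exchanging the vertices *)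

Lemma Cminus_irredundant (K : fieldType) :
  irredundant (Cminus_plus K) (Cminus_minus K).
Proof.
split=> [m n _ _|m n|m n m1|m m1|m]; rewrite ?Cminus_plus_dim ?Cminus_minus_dim.
- by move/module_iso_dim; rewrite !Cminus_plus_dim => -[].
- by move/module_iso_dim; rewrite !Cminus_minus_dim => -[].
- by move/module_iso_dim; rewrite Cminus_plus_dim Cminus_minus_dim => -[]; lia.
- by case; lia.
- by case; lia.
Qed.

Lemma parameterized_Y (K : fieldType) (R : realType) (zeta : 'rV[R]_2) :
  zeta 0 0 < zeta 0 1 -> parameterized_by_Y K zeta.
Proof.
move=> zlt; split=> [p|W /(stable_ratio _ zlt)|p|a b p].
- by split; [apply/stable_ratio => //; apply: taut_Y_stable | apply: taut_Y_dim].
- exact: ratio_stable_taut_Y.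
- exact: taut_Y_lies_over.
- exact: taut_Y_class.
Qed.

Lemma swap_dim (K : fieldType) (W : conifold_module K) d0 d1 :
  dim_vector W = (d0, d1) <-> dim_vector (swap W) = (d1, d0).
Proof. by rewrite /dim_vector; split=> -[e0 e1]; congr pair. Qed.

(** By computation, [swap] turns [Cplus_plus m.+1] into [Cminus_minus m] and [Cplus_minus m] into
    [Cminus_plus m.+1]: the two families trade places and the index shifts by one. *)
Lemma Cplus_irredundant (K : fieldType) :
  irredundant (Cplus_plus K) (Cplus_minus K).
Proof.
have [iP iN iPN dP dN] := Cminus_irredundant K.
split=> [[|m] [|n] // _ _|m n|[|m] n // _|[|m] // _|m].
- by move/module_iso_swap=> mn; congr _.+1; apply: iN.
- by move/module_iso_swap=> mn; have [] := iP m.+1 n.+1 isT isT mn.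
- by move/module_iso_swap/module_iso_sym; apply: (iPN n.+1).
- by move/swap_dim; apply: (dN m).
- by move/swap_dim; apply: (dP m.+1).
Qed.

(** By computation, [swap] turns [taut_Yplus p] into [taut_Y p] and [rep11 a b] into [rep11 b a],
    while [class_Yplus a b] is [class_Y b a]. Exchanging the arrows [a] and [b] interchanges the
    functions z and w, as [f_Yplus] does. *)
Lemma parameterized_Yplus (K : fieldType) (R : realType) (zeta : 'rV[R]_2) :
  zeta 0 1 < zeta 0 0 -> parameterized_by_Yplus K zeta.
Proof.
move=> zlt; split=> [p|W /(stable_ratio_swap _ zlt) sW /swap_dim d11|p|a b p].
- by split; [apply/stable_ratio_swap => //; apply: (taut_Y_stable p)
            | apply/swap_dim; apply: (taut_Y_dim p)].
- have [p [Wp p_uniq]] := ratio_stable_taut_Y sW d11.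
  exists p; split=> [|q Wq]; first exact/module_iso_swap.
  by apply: p_uniq; apply/module_iso_swap.
- have [[ab00 ba00] [ab11 ba11] [ab01 ba01] [ab10 ba10]] := taut_Y_lies_over p.
  by split; split.
- by rewrite -taut_Y_class; apply: module_iso_swap.
Qed.

Unset Implicit Arguments.

Theorem theorem3p5 (R : realType) (zeta : 'rV[R]_2) :
  (zeta 0 0 < zeta 0 1 ->
     [/\ forall W : conifold_module R[i],
           stable zeta W <->
           [\/ exists2 m, (1 <= m)%N & module_iso W (Cminus_plus R[i] m),
               stable zeta W /\ dim_vector W = (1, 1)%N
             | exists m, module_iso W (Cminus_minus R[i] m)],
         irredundant (Cminus_plus R[i]) (Cminus_minus R[i])
       & parameterized_by_Y R[i] zeta]) /\
  (zeta 0 1 < zeta 0 0 ->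
     [/\ forall W : conifold_module R[i],
           stable zeta W <->
           [\/ exists2 m, (1 <= m)%N & module_iso W (Cplus_plus R[i] m),
               stable zeta W /\ dim_vector W = (1, 1)%N
             | exists m, module_iso W (Cplus_minus R[i] m)],
         irredundant (Cplus_plus R[i]) (Cplus_minus R[i])
       & parameterized_by_Yplus R[i] zeta]).
Proof.
split=> zlt; split.
- move=> W; have stW := stable_ratio W zlt; split=> [sW|].
    by case: (ratio_stable_cases (stW.1 sW)) => ?; [apply: Or31|apply: Or32|apply: Or33].
  case=> [[m m_gt0 Wm]|[]//|[m Wm]]; apply/stW; apply: ratio_stable_iso Wm _.
    exact: Cminus_plus_stable.
  exact: Cminus_minus_stable.
- exact: Cminus_irredundant.
- exact: parameterized_Y.
- move=> W; have stW := stable_ratio_swap W zlt; split=> [sW|].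
    (* The classification is applied to [swap W], so its first and third alternatives become the
       third and the first for [W]. *)
    have [[[//|m] _ Wm]|d11|[m Wm]] := ratio_stable_cases (stW.1 sW).
    + by apply: Or33; exists m; apply/module_iso_swap.
    + by apply: Or32; split=> //; apply/swap_dim.
    + by apply: Or31; exists m.+1 => //; apply/module_iso_swap.
  case=> [[[//|m] _ /module_iso_swap Wm]|[]//|[m /module_iso_swap Wm]];
    apply/stW; apply: ratio_stable_iso Wm _.
    exact: (Cminus_minus_stable _ m).
  exact: (@Cminus_plus_stable _ m.+1).
- exact: Cplus_irredundant.
- exact: parameterized_Yplus.
Qed.
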